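(* Let $\{X(k)\}_{k\geqslant 1}$ be the family of graphs defined in the context. For all $k\geqslant 1$, the chromatic polynomial $P_{X(k)}(q)$ has a factor of $(q-2)^k$. For all $k \geqslant 3$, the graph $X(k)$ is $3$-connected and has no complete cutset.
   Context: For a finite simple graph $G$, the chromatic polynomial $P_G$ is the unique polynomial such that $P_G(q)$ equals the number of proper $q$-colourings of $G$ for every non-negative integer $q$. A graph is $3$-connected if it has more than $3$ vertices and deleting any set of fewer than $3$ vertices leaves a connected graph. A complete cutset of a connected graph is a set of pairwise adjacent vertices whose deletion disconnects the graph. The graph $X(k)$ ($k\geqslant 1$) is obtained from the $k$-spoke wheel by replacing each of the $k$ rim vertices (each of degree $3$) with a copy of $K_{3,3}$ as follows: the vertex is replaced by a triangle (each of the three edges formerly at the vertex being attached to a different triangle vertex), then each edge of the triangle is subdivided once, and each subdividing vertex is joined to the one triangle vertex to which it is not already adjacent. (The $1$-spoke wheel is a single edge with a loop at one end, that end being the rim vertex; the $2$-spoke wheel is a $3$-vertex path with a double edge added between its two end-vertices, those being the rim vertices.) Explicitly, $X(k)$ is the simple graph on $6k+1$ vertices: a hub vertex $h$ and, for each $i \in \mathbb{Z}/k\mathbb{Z}$, six vertices $l_i, m_i, r_i, a_i, b_i, c_i$. Its edges are: for each $i$, all nine edges between $\{l_i,m_i,r_i\}$ and $\{a_i,b_i,c_i\}$; for each $i$, the edge $h m_i$; and for each $i$, the edge $r_i l_{i+1}$, with indices modulo $k$ (so for $k=1$ this is the edge $r_0 l_0$). *)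

(* Defs.v *)
From mathcomp Require Import all_boot all_order all_algebra.

Set Implicit Arguments.
Unset Strict Implicit.
Unset Printing Implicit Defensive.

Import GRing.Theory Num.Theory.
Local Open Scope ring_scope.

Record sgraph := SGraph {
  svertex :> finType;
  sadj : rel svertex;
  sadj_sym : symmetric sadj;
  sadj_irrefl : irreflexive sadj
}.

Arguments sadj {G} : rename.

Section ChromaticPolynomial.

Definition proper_colouring (G : sgraph) (q : nat) (f : {ffun G -> 'I_q}) : bool :=
  [forall x : G, forall y : G, sadj x y ==> (f x != f y)].

Definition num_proper_colourings (G : sgraph) (q : nat) : nat :=
  #|[set f : {ffun G -> 'I_q} | proper_colouring f]|.

Definition is_chromatic_poly (G : sgraph) (P : {poly int}) : Prop :=
  forall q : nat, P.[q%:R] = (num_proper_colourings G q)%:R.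

Lemma is_chromatic_poly_unique (G : sgraph) (P Q : {poly int}) :
  is_chromatic_poly G P -> is_chromatic_poly G Q -> P = Q.
Proof.
move=> hP hQ; apply/eqP; rewrite -subr_eq0; apply/eqP.
pose s := [seq (i%:R : int) | i <- iota 0 (size (P - Q))].
apply: (@roots_geq_poly_eq0 _ _ s); last by rewrite size_map size_iota.
  by apply/allP => _ /mapP[i _ ->]; rewrite rootE hornerD hornerN hP hQ subrr.
by rewrite map_inj_uniq ?iota_uniq // => i j /eqP; rewrite eqr_nat => /eqP.
Qed.

Section Existence.
Variable G : sgraph.

Definition constant_along (q : nat) (A : {set G * G}) (f : {ffun G -> 'I_q}) : bool :=
  [forall p in A, f p.1 == f p.2].

Definition sym_rel (A : {set G * G}) : rel G :=
  [rel x y | ((x, y) \in A) || ((y, x) \in A)].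

Lemma sym_rel_connect_sym A : connect_sym (sym_rel A).
Proof. by apply: sym_connect_sym => x y; exact: orbC. Qed.

Lemma card_constant_along (q : nat) (A : {set G * G}) :
  #|[set f | @constant_along q A f]| = (q ^ #|roots (sym_rel A)|)%N.
Proof.
have csA := sym_rel_connect_sym A.
pose e := sym_rel A.
pose rt x : {x : G | roots e x} := exist _ (fingraph.root e x) (roots_root csA x).
pose ext (g : {ffun {x : G | roots e x} -> 'I_q}) : {ffun G -> 'I_q} :=
  [ffun x => g (rt x)].
have ext_inj : injective ext.
  move=> g1 g2 /ffunP eg; apply/ffunP => -[x rx].
  have := eg x; rewrite !ffunE; suff -> : rt x = exist _ x rx by [].
  by apply: val_inj; apply/eqP.
have -> : [set f | constant_along A f] = ext @: setT.
  apply/setP=> f; rewrite inE; apply/idP/imsetP => [/forall_inP fA | [g _ ->]].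
    exists [ffun u => f (val u)] => //; apply/ffunP => x; rewrite !ffunE /=.
    have /connectP[s es ->] := connect_root e x.
    elim: s x es => //= y s IHs x /andP[exy /IHs <-].
    by case/orP: exy => /fA /eqP /=.
  apply/forall_inP => -[x y] /= Axy; rewrite !ffunE; apply/eqP; congr (g _).
  apply: val_inj => /=; apply/(fingraph.rootP csA)/connect1.
  by rewrite /sym_rel /= Axy.
rewrite (card_imset _ ext_inj) cardsT card_ffun card_ord card_sig.
by congr (_ ^ _)%N; apply: eq_card.
Qed.

(* Whitney's expansion, over sets of oriented edges. *)
Lemma chromatic_poly_exists : {P : {poly int} | is_chromatic_poly G P}.
Proof.
pose E := [set p : G * G | sadj p.1 p.2].
exists (\sum_(A : {set G * G} | A \subset E)
          ((-1) ^+ #|A| *: 'X^(#|roots (sym_rel A)|))) => q.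
rewrite horner_sum.
transitivity (\sum_(A : {set G * G} | A \subset E)
   \sum_(f : {ffun G -> 'I_q}) ((-1) ^+ #|A| * (constant_along A f)%:R) : int).
  apply: eq_bigr => A _; rewrite hornerZ hornerXn -natrX -card_constant_along.
  rewrite -mulr_sumr; congr (_ * _).
  rewrite -sum1_card natr_sum big_mkcond /=; apply: eq_bigr => f _.
  by rewrite inE; case: constant_along.
rewrite exchange_big /= /num_proper_colourings -sum1_card natr_sum big_mkcond /=.
rewrite [RHS]big_mkcond /=; apply: eq_bigr => f _; rewrite inE.
pose F (p : G * G) : int := - ((sadj p.1 p.2 && (f p.1 == f p.2))%:R).
transitivity (\prod_(p : G * G) (F p + 1)).
  rewrite bigA_distr [LHS]big_mkcond /=; apply: eq_bigr => A _.
  rewrite -big_mkcond /=.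
  case: ifP => [/subsetP AE | /negbT/subsetPn[p pA pE]].
    case: (boolP (constant_along A f)) => [/forall_inP fA | /forall_inPn[p pA fp]].
      rewrite mulr1 -prodr_const; apply: eq_bigr => p pA.
      by rewrite /F fA // andbT; have := AE p pA; rewrite inE => ->.
    by rewrite mulr0 (bigD1 p) //= /F (negPf fp) andbF oppr0 mul0r.
  by rewrite (bigD1 p) //= /F; move: pE; rewrite inE => /negPf->; rewrite oppr0 mul0r.
case: (boolP (proper_colouring f)) => [/forallP pf | ].
  rewrite big1 // => -[x y] _; rewrite /F /=.
  have /forallP/(_ y) := pf x.
  by case: (sadj x y) => //= /negPf->; rewrite oppr0 add0r.
case/forallPn => x /forallPn[y]; rewrite negb_imply negbK => exy.
by rewrite (bigD1 (x, y)) //= /F /= exy addNr mul0r.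
Qed.

End Existence.

Definition chromatic_poly (G : sgraph) : {poly int} :=
  sval (chromatic_poly_exists G).

Lemma chromatic_polyP (G : sgraph) : is_chromatic_poly G (chromatic_poly G).
Proof. exact: svalP (chromatic_poly_exists G). Qed.

End ChromaticPolynomial.

Section Connectivity.

(* The subgraph induced on [A] is connected (the empty one counts as
   connected). *)
Definition connected_on (G : sgraph) (A : {set G}) : bool :=
  [forall x in A, forall y in A,
     connect [rel u v : G | [&& u \in A, v \in A & sadj u v]] x y].

Definition three_connected (G : sgraph) : Prop :=
  (3 < #|G|)%N /\ forall S : {set G}, (#|S| < 3)%N -> connected_on (~: S).

Definition complete_cutset (G : sgraph) (S : {set G}) : Prop :=
  (forall x y : G, x \in S -> y \in S -> x != y -> sadj x y) /\
  ~~ connected_on (~: S).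

End Connectivity.

Section GraphX.
Variable k : nat.

(* [None] is the hub h; [Some (i, inl s)] is l_i, m_i, r_i for s = 0, 1, 2, and
   [Some (i, inr t)] is a_i, b_i, c_i for t = 0, 1, 2. *)
Definition X_vertex : finType := option ('I_k * ('I_3 + 'I_3)).

Definition X_hub : X_vertex := None.
Definition X_l (i : 'I_k) : X_vertex := Some (i, inl (inord 0)).
Definition X_m (i : 'I_k) : X_vertex := Some (i, inl (inord 1)).
Definition X_r (i : 'I_k) : X_vertex := Some (i, inl (inord 2)).

(* Each edge in one direction; [ordS i] is i + 1 modulo k. *)
Definition X_arc (u v : X_vertex) : bool :=
  [|| [exists i : 'I_k, exists s : 'I_3, exists t : 'I_3,
         (u == Some (i, inl s)) && (v == Some (i, inr t))],
      [exists i : 'I_k, (u == X_hub) && (v == X_m i)]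
    | [exists i : 'I_k, (u == X_r i) && (v == X_l (ordS i))]].

Definition X_adj : rel X_vertex := [rel u v | X_arc u v || X_arc v u].

Lemma X_adj_sym : symmetric X_adj.
Proof. by move=> u v; exact: orbC. Qed.

Lemma X_adj_irrefl : irreflexive X_adj.
Proof.
move=> u; apply/negP; rewrite /X_adj /= orbb => /or3P[].
- by case/existsP=> i /existsP[s] /existsP[t] /andP[/eqP-> /eqP].
- by case/existsP=> i /andP[/eqP-> /eqP].
case/existsP=> i /andP[/eqP->]; rewrite /X_r /X_l => /eqP[_].
by move/(congr1 val); rewrite /= !inordK.
Qed.

Definition X : sgraph := SGraph X_adj_sym X_adj_irrefl.

End GraphX.

(* Main.v *)
Require Import Defs.
From mathcomp Require Import all_boot all_order all_algebra.
From mathcomp Require Import ring zify.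

(** Factor of the chromatic polynomial.  Fix the colour h of the hub.  A
    colouring of the rest of X(k) is a cyclic sequence of colourings of the k
    copies of K_{3,3}, and the only interaction between consecutive copies is
    that the end r_i differs from l_(i+1).  Hence the number of colourings is
    the sum over h of the trace of the k-th power of a q x q transfer matrix
    A_h = W_h N ([count_colourings]); here W_h x y counts the colourings of one
    copy with ends x and y whose middle vertex avoids h, and N is the 0-1
    matrix of x != y.

    These matrices commute with all permutations of the colours other than h,
    so each is described by five numbers ([hubmx]) that are polynomials in q.
    Put t = q - 2.  Not every entry of A_h is divisible by t, but the diagonal
    entry at h and both parameters of the block off h are divisible by t, and
    the entries from h to the other colours are divisible by t^2
    ([transfermx_graded]).  So conjugating by the diagonal matrix with entry 1
    at h and t elsewhere makes t a common factor of A_h.  Equivalently, the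
    n-th power has the same shape with t^n, t^(n+1), t^(n-1), t^n in the four
    positions ([graded_hubmx_exp]), and the trace of the k-th power is t^k
    times a polynomial in q.  Two polynomials that agree at every natural
    number are equal, which turns this into a divisibility of polynomials.

    Connectivity.  Let at most two vertices be deleted.  Each copy of K_{3,3}
    stays nonempty and connected.  If the hub survives, a copy whose middle
    vertex survives is joined to it directly; otherwise the middle vertex is
    one of the deleted ones, at most one more is deleted, and it cannot block
    both the passage through the next copy and the one through the previous
    copy, because these are different copies when k >= 3 ([linked_hub]).  If
    the hub is deleted, at most one link between consecutive copies is broken,
    and the cycle of copies minus one link is connected ([linked_rim]).
    Finally X(k) has no triangle when k >= 3, so a clique has at most two
    vertices and is not a cutset. *)

Set Implicit Arguments.
Unset Strict Implicit.
Unset Printing Implicit Defensive.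

Import GRing.Theory.
Local Open Scope ring_scope.

(** * Closed walks and traces of matrix powers *)

Section CyclicWords.
Variables (R : comNzRingType) (T : finType).

Definition fcons n (z : T) (g : {ffun 'I_n -> T}) : {ffun 'I_n.+1 -> T} :=
  [ffun i => if unlift ord0 i is Some j then g j else z].

Lemma fcons0 n z (g : {ffun 'I_n -> T}) : fcons z g ord0 = z.
Proof. by rewrite ffunE unlift_none. Qed.

Lemma fconsS n z (g : {ffun 'I_n -> T}) i : fcons z g (lift ord0 i) = g i.
Proof. by rewrite ffunE liftK. Qed.

Lemma big_fcons n (F : {ffun 'I_n.+1 -> T} -> R) :
  \sum_f F f = \sum_z \sum_(g : {ffun 'I_n -> T}) F (fcons z g).
Proof.
rewrite pair_bigA /=.
rewrite (reindex (fun p : T * {ffun 'I_n -> T} => fcons p.1 p.2)) //=.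
exists (fun f : {ffun 'I_n.+1 -> T} => (f ord0, [ffun i => f (lift ord0 i)])).
  move=> [z g] _ /=; rewrite fcons0; congr pair.
  by apply/ffunP => i; rewrite ffunE fconsS.
move=> f _ /=; apply/ffunP => i.
by case: (unliftP ord0 i) => [j|] ->; rewrite ?fconsS ?fcons0 ?ffunE.
Qed.

End CyclicWords.

Section TracePower.
Variables (R : comNzRingType) (q : nat) (A : 'M[R]_q).

Lemma expmx_walks n x y :
  (A ^+ n.+1) x y =
  \sum_(g : {ffun 'I_n -> 'I_q})
    (\prod_(i < n) A (fcons x g (widen_ord (leqnSn n) i)) (fcons x g (lift ord0 i)))
      * A (fcons x g ord_max) y.
Proof.
elim: n x => [|n IHn] x.
  rewrite (big_pred1 [ffun=> x]) => [|g]; last first.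
    by apply/esym/eqP/ffunP => -[].
  by rewrite big_ord0 mul1r (_ : ord_max = ord0) ?fcons0 //; apply: val_inj.
rewrite exprS -mulmxE mxE big_fcons; apply: eq_bigr => z _.
rewrite IHn mulr_sumr; apply: eq_bigr => g _.
rewrite big_ord_recl !mulrA (_ : widen_ord _ _ = ord0); last exact: val_inj.
rewrite fcons0 fconsS fcons0 (_ : ord_max = lift ord0 ord_max); last exact: val_inj.
rewrite fconsS; congr (_ * _ * _); apply: eq_bigr => i _.
rewrite (_ : widen_ord _ _ = lift ord0 (widen_ord (leqnSn n) i)); last exact: val_inj.
by rewrite !fconsS.
Qed.

(** Closed walks of length n.+1 are the walks counted by a diagonal entry; the
    factor at the last index is the step that closes the walk. *)
Lemma mxtrace_exp n :
  \tr (A ^+ n.+1) =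
  \sum_(f : {ffun 'I_n.+1 -> 'I_q}) \prod_i A (f i) (f (ordS i)).
Proof.
rewrite big_fcons; apply: eq_bigr => x _; rewrite expmx_walks.
apply: eq_bigr => g _; rewrite big_ord_recr /=; congr (_ * A _ _); last first.
  by rewrite (_ : ordS _ = ord0) ?fcons0 //; apply: val_inj => /=; rewrite modnn.
apply: eq_bigr => i _; congr (A _ (fcons x g _)); apply: val_inj => /=.
by rewrite modn_small // ltnS.
Qed.

End TracePower.

(** Transfer matrix method.  The weight of a cyclic sequence of states depends
    on neighbouring states only through a left and a right end, so the states
    can be summed out with the ends held fixed.  The right-hand side is the sum
    over all prescriptions f of the left ends, and each g is counted at exactly
    one f. *)
Lemma transfer_trace (R : comNzRingType) (C : finType) (q n : nat)
    (phi : C -> R) (l r : C -> 'I_q) (N : 'M[R]_q) :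
  \sum_(g : {ffun 'I_n.+1 -> C}) \prod_i (phi (g i) * N (r (g i)) (l (g (ordS i)))) =
  \tr (((\matrix_(x, y) \sum_(c | (l c == x) && (r c == y)) phi c) *m N) ^+ n.+1).
Proof.
rewrite mxtrace_exp.
pose B x x' c := (l c == x)%:R * (phi c * N (r c) x').
transitivity (\sum_(f : {ffun 'I_n.+1 -> 'I_q}) \prod_i \sum_c B (f i) (f (ordS i)) c);
  last first.
  apply: eq_bigr => f _; apply: eq_bigr => i _; rewrite mxE.
  rewrite (partition_big r predT) //=; apply: eq_bigr => y _.
  rewrite mxE mulr_suml [LHS]big_mkcond [RHS]big_mkcond /=; apply: eq_bigr => c _.
  rewrite andbC /B; case: eqP => [->|_] //=.
  by case: (l c == f i); rewrite ?mul1r ?mul0r.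
transitivity (\sum_(f : {ffun 'I_n.+1 -> 'I_q}) \sum_(g : {ffun 'I_n.+1 -> C})
    \prod_i B (f i) (f (ordS i)) (g i)); last first.
  by apply: eq_bigr => f _; rewrite bigA_distr_bigA.
rewrite exchange_big /=; apply: eq_bigr => g _.
rewrite (bigD1 [ffun i => l (g i)]) //= [X in _ + X]big1 ?addr0.
  by apply: eq_bigr => i _; rewrite /B !ffunE eqxx mul1r.
move=> f /eqP fN; case: (altP (@forallP _ (fun i => l (g i) == f i))) => [fE|].
  by case: fN; apply/ffunP => i; rewrite ffunE; apply/esym/eqP.
by case/forallPn => i /negPf li; rewrite (bigD1 i) //= /B li !mul0r.
Qed.

(** * Matrices invariant under the colour permutations that fix the hub colour *)

Section HubMatrices.
Variables (q : nat) (h : 'I_q).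

(** The matrices that commute with every permutation of the colours fixing h:
    an entry depends only on which of its indices are h and whether they agree. *)
Definition hubmx (a b c d e : int) : 'M[int]_q :=
  \matrix_(x, y) (if x == h then if y == h then a else b
                  else if y == h then c else (x == y)%:R * d + e).

Lemma sum_nonhub (a : int) : \sum_(z | z != h) a = (q%:R - 1) * a.
Proof.
have q_gt0 : (0 < q)%N by exact: leq_ltn_trans (ltn_ord h).
rewrite sumr_const cardC1 card_ord -[LHS]mulr_natl; congr (_ * _).
by rewrite -[in RHS](prednK q_gt0) mulrSr addrK.
Qed.

Lemma sum_nonhub_delta (x : 'I_q) (F : 'I_q -> int) : x != h ->
  \sum_(z | z != h) (x == z)%:R * F z = F x.
Proof.
move=> xh; rewrite (bigD1 x) //= eqxx mul1r big1 ?addr0 // => z /andP[_ zx].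
by rewrite eq_sym (negPf zx) mul0r.
Qed.

Lemma sum_nonhub_row (x : 'I_q) (d e : int) : x != h ->
  \sum_(z | z != h) ((x == z)%:R * d + e) = d + (q%:R - 1) * e.
Proof. by move=> xh; rewrite big_split /= sum_nonhub (sum_nonhub_delta (fun=> d)). Qed.

Lemma sum_nonhub_mul (x y : 'I_q) (d e d' e' : int) : x != h -> y != h ->
  \sum_(z | z != h) ((x == z)%:R * d + e) * ((z == y)%:R * d' + e') =
  (x == y)%:R * (d * d') + (d * e' + e * d' + (q%:R - 1) * (e * e')).
Proof.
move=> xh yh.
transitivity (\sum_(z | z != h)
   ((x == z)%:R * (d * ((z == y)%:R * d' + e')) + ((y == z)%:R * (e * d') + e * e'))).
  by apply: eq_bigr => z _; rewrite (eq_sym y); ring.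
rewrite !big_split /= sum_nonhub !sum_nonhub_delta //; ring.
Qed.

Lemma hubmxM a b c d e a' b' c' d' e' :
  hubmx a b c d e *m hubmx a' b' c' d' e' =
  hubmx (a * a' + (q%:R - 1) * (b * c'))
        (a * b' + b * (d' + (q%:R - 1) * e'))
        (c * a' + (d + (q%:R - 1) * e) * c')
        (d * d')
        (c * b' + (d * e' + e * d' + (q%:R - 1) * (e * e'))).
Proof.
apply/matrixP => x y; rewrite !mxE (bigD1 h) //= !mxE eqxx.
have [-> | xh] := eqVneq x h; have [-> | yh] := eqVneq y h.
- congr (_ + _); rewrite -sum_nonhub; apply: eq_bigr => z zh.
  by rewrite !mxE eqxx (negPf zh).
- congr (_ + _); rewrite -(sum_nonhub_row d' e' yh) mulr_sumr.
  by apply: eq_bigr => z zh; rewrite !mxE eqxx (negPf zh) (negPf yh) eq_sym.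
- congr (_ + _); rewrite -(sum_nonhub_row d e xh) mulr_suml.
  by apply: eq_bigr => z zh; rewrite !mxE eqxx (negPf zh) (negPf xh).
- rewrite [RHS]addrCA; congr (_ + _); rewrite -sum_nonhub_mul //.
  by apply: eq_bigr => z zh; rewrite !mxE (negPf zh) (negPf xh) (negPf yh).
Qed.

Lemma mxtrace_hubmx a b c d e :
  \tr (hubmx a b c d e) = a + (q%:R - 1) * (d + e).
Proof.
rewrite /mxtrace (bigD1 h) //= mxE eqxx -sum_nonhub; congr (_ + _).
by apply: eq_bigr => z zh; rewrite mxE (negPf zh) eqxx mul1r.
Qed.

End HubMatrices.

(** The exponents are those of t^(n+1) times an arbitrary invariant matrix,
    after conjugation by the diagonal matrix with entry 1 at h and t elsewhere;
    this is what makes them add up under multiplication.  The coefficients are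
    polynomials, the same ones for all q and h. *)
Definition graded_hubmx n (a b c d e : {poly int}) q (h : 'I_q) : 'M[int]_q :=
  let t := q%:R - 2 in
  hubmx h (t ^+ n.+1 * a.[q%:R]) (t ^+ n.+2 * b.[q%:R]) (t ^+ n * c.[q%:R])
          (t ^+ n.+1 * d.[q%:R]) (t ^+ n.+1 * e.[q%:R]).

Lemma graded_hubmx_exp (A : forall q, 'I_q -> 'M[int]_q) a b c d e n :
  (forall q (h : 'I_q), A q h = graded_hubmx 0 a b c d e h) ->
  exists a' b' c' d' e', forall q (h : 'I_q),
    A q h ^+ n.+1 = graded_hubmx n a' b' c' d' e' h.
Proof.
move=> AE; elim: n => [|n [a' [b' [c' [d' [e' IHn]]]]]].
  by exists a, b, c, d, e => q h; rewrite AE.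
(* s.[q] = q - 1 is the number of colours other than h. *)
pose s : {poly int} := 'X - 1%:P.
exists (a * a' + s * (b * c')), (a * b' + b * (d' + s * e')),
  (c * a' + (d + s * e) * c'), (d * d'),
  (c * b' + (d * e' + e * d' + s * (e * e'))) => q h.
rewrite exprS -mulmxE IHn AE /graded_hubmx hubmxM; congr hubmx;
  rewrite !(hornerXsubC, hornerD, hornerM) !exprS; ring.
Qed.

(** * The transfer matrix of one copy of K_{3,3} *)

Section Blocks.
Variables (q : nat) (h : 'I_q).

(** Once l, m, r have colours x, z, y, the three vertices a, b, c are coloured
    independently of each other, whence the cube. *)
Definition blockmx : 'M[int]_q :=
  \matrix_(x, y) \sum_(z | z != h) (\sum_w ((w \notin [:: x; z; y])%:R : int)) ^+ 3.

Lemma count_avoiding (x y z : 'I_q) :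
  \sum_w ((w \notin [:: x; z; y])%:R : int) =
  q%:R - 1 - (y != x)%:R - ((z != x) && (z != y))%:R.
Proof.
have delta (u : 'I_q) (a : int) : \sum_w (w == u)%:R * a = a.
  by rewrite (bigD1 u) //= eqxx mul1r big1 ?addr0 // => w /negPf->; rewrite mul0r.
transitivity (\sum_w (1 - (w == x)%:R * 1 - (w == y)%:R * (y != x)%:R
   - (w == z)%:R * ((z != x) && (z != y))%:R) : int).
  apply: eq_bigr => w _; rewrite !inE.
  have [->|wx] := eqVneq w x.
    by rewrite (eq_sym x y) (eq_sym x z); case: (y == x); case: (z == x) => //=; ring.
  have [E|wy] := eqVneq w y.
    rewrite -E wx (eq_sym w z); case: (z == w); rewrite /= ?andbF ?andbT /=; ring.
  by have [<-|_] := eqVneq w z; rewrite ?wx ?wy /=; ring.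
by rewrite !sumrB !delta sumr_const card_ord.
Qed.

(** The term for z takes one of two values, according to whether z repeats one
    of x and y; writing it with the indicators of z = x and z = y reduces the
    sum over z to counting. *)
Lemma blockmxE (t := q%:R - 2 : int) (w1 := t ^+ 3 + t * (t - 1) ^+ 3)
    (we := 2 * t ^+ 3 + (t - 1) ^+ 4) :
  blockmx = hubmx h ((t + 1) * t ^+ 3) w1 w1 ((t + 1) ^+ 3 + t ^+ 4 - we) we.
Proof.
have delta (u : 'I_q) (a : int) : \sum_(z | z != h) (u == z)%:R * a = (u != h)%:R * a.
  have [->|uh] := eqVneq u h; last by rewrite (sum_nonhub_delta (fun=> a)) ?mul1r.
  by rewrite mul0r big1 // => z; rewrite eq_sym => /negPf->; rewrite mul0r.
apply/matrixP => x y; rewrite !mxE.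
(* c and c - 1 are the numbers of choices for each of a, b, c when z is, or is
   not, one of x and y. *)
pose c : int := q%:R - 1 - (y != x)%:R.
pose D : int := c ^+ 3 - (c - 1) ^+ 3.
transitivity (\sum_(z | z != h)
    ((x == z)%:R * D + (y == z)%:R * ((y != x)%:R * D) + (c - 1) ^+ 3)).
  apply: eq_bigr => z _; rewrite count_avoiding -/c /D (eq_sym x z) (eq_sym y z).
  have [->|zx] := eqVneq z x; first by rewrite eq_sym; case: (y == x) => /=; ring.
  have [E|zy] := eqVneq z y; last by rewrite /=; ring.
  by rewrite -E zx /=; ring.
rewrite !big_split /= !delta sum_nonhub /D /c /we /w1 /t.
have [->|xh] := eqVneq x h; have [yE|yh] := eqVneq y h;
  rewrite ?yE ?eqxx /=.
- ring.
- ring.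
- by rewrite (eq_sym h) xh /=; ring.
- by rewrite eq_sym; case: (x == y); rewrite /=; ring.
Qed.

Definition neqmx : 'M[int]_q := \matrix_(x, y) (x != y)%:R.

Lemma neqmxE : neqmx = hubmx h 0 1 1 (-1) 1.
Proof.
apply/matrixP => x y; rewrite !mxE.
have [->|xh] := eqVneq x h; first by rewrite eq_sym; case: (y == h).
have [->|yh] := eqVneq y h; first by rewrite xh.
by case: (x == y).
Qed.

End Blocks.

(** The crucial divisibilities.  Modulo q - 2, the matrix W_h is 1 on pairs of
    colours other than h and 0 elsewhere, and the entry x, y of W_h N is the sum
    of W_h x z over the colours z other than y.  For y other than h, these z are
    h, which contributes 0 modulo q - 2, and q - 2 further colours, on which the
    summand is constant modulo q - 2.  For x = h each summand is divisible by
    q - 2; if also y is not h, the q - 2 summands with z other than h are equal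
    and together divisible by the square, while W_h h h is divisible by the
    cube. *)
Lemma transfermx_graded : exists a b c d e, forall q (h : 'I_q),
  blockmx h *m neqmx q = graded_hubmx 0 a b c d e h.
Proof.
pose t : {poly int} := 'X - 2%:P; pose s := t - 1%:P; pose u := t + 1%:P.
pose we := 2%:P * t ^+ 3 + s ^+ 4.
pose w := t ^+ 2 + s ^+ 3.
pose wd := 3%:P * t ^+ 2 - 3%:P * t + 7%:P.
(* t * w is the value of W_h between h and another colour; on the colours other
   than h, we is the off-diagonal value and we + t * wd the diagonal one. *)
exists (u * w), (u * t + w), (t * wd + u * we), (- wd), (w + wd + we) => q h.
rewrite blockmxE (neqmxE h) hubmxM /graded_hubmx; congr hubmx;
 rewrite /wd /w /we /s /u /t !(hornerXsubC, hornerD, hornerM, hornerN, hornerC, horner_exp).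
all: ring.
Qed.

(** * Colourings of X(k) *)

Section Colourings.
Variables (k q : nat).

(** The colours of l, m, r and of the triple a, b, c in one copy. *)
Definition block_colour : finType := ('I_q * 'I_q * 'I_q * {ffun 'I_3 -> 'I_q})%type.
Definition colour_l (c : block_colour) := c.1.1.1.
Definition colour_m (c : block_colour) := c.1.1.2.
Definition colour_r (c : block_colour) := c.1.2.
Definition colour_abc (c : block_colour) := c.2.

Definition paint (h : 'I_q) (g : {ffun 'I_k -> block_colour}) : {ffun X k -> 'I_q} :=
  (* The default h of nth is never reached, as s < 3. *)
  [ffun v : X_vertex k => match v with
    | None => h
    | Some (i, inl s) => nth h [:: colour_l (g i); colour_m (g i); colour_r (g i)] s
    | Some (i, inr t) => colour_abc (g i) t
    end].

Lemma big_paint (F : {ffun X k -> 'I_q} -> int) :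
  \sum_f F f = \sum_h \sum_(g : {ffun 'I_k -> block_colour}) F (paint h g).
Proof.
rewrite pair_bigA /=.
rewrite (reindex (fun p : 'I_q * {ffun 'I_k -> block_colour} => paint p.1 p.2)) //=.
exists (fun f : {ffun X k -> 'I_q} => (f (X_hub k),
   [ffun i => (f (X_l i), f (X_m i), f (X_r i), [ffun t => f (Some (i, inr t))])])).
  move=> [h g] _ /=; rewrite ffunE /=; congr pair.
  apply/ffunP => i; rewrite !ffunE /= !inordK //.
  rewrite (_ : [ffun t => _] = colour_abc (g i)); first by case: (g i) => [[[]]].
  by apply/ffunP => t; rewrite !ffunE.
move=> f _; apply/ffunP => -[[i [s|t]]|]; rewrite ffunE //=; last by rewrite !ffunE.
by rewrite ffunE; case: s => [[|[|[|s]]] s3] //=; congr (f (Some (i, inl _)));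
  apply: val_inj; rewrite /= inordK.
Qed.

Lemma prod_natb (I : finType) (b : pred I) : \prod_i ((b i)%:R : int) = [forall i, b i]%:R.
Proof.
have [/forallP bT|/forallPn[i /negPf bi]] := boolP [forall i, b i].
  by rewrite big1 // => i _; rewrite bT.
by rewrite (bigD1 i) //= bi mul0r.
Qed.

Definition block_weight (h : 'I_q) (c : block_colour) : int :=
  (colour_m c != h)%:R *
  \prod_t (colour_abc c t \notin [:: colour_l c; colour_m c; colour_r c])%:R.

(** Every edge is charged to one copy: the spoke and the nine inner edges to the
    block weight, the rim edge leaving r_i to the factor N. *)
Lemma proper_paint (h : 'I_q) (g : {ffun 'I_k -> block_colour}) :
  (proper_colouring (paint h g))%:R =
  \prod_i (block_weight h (g i) * neqmx q (colour_r (g i)) (colour_l (g (ordS i)))).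
Proof.
pose P (i : 'I_k) :=
  [&& colour_m (g i) != h,
      [forall t, colour_abc (g i) t
                   \notin [:: colour_l (g i); colour_m (g i); colour_r (g i)]]
    & colour_r (g i) != colour_l (g (ordS i))].
have -> : proper_colouring (paint h g) = [forall i, P i].
  apply/idP/idP => [/forallP prop | /forallP PP].
    have adjneq u v : X_arc u v -> paint h g u != paint h g v.
      by move=> uv; have /forallP/(_ v)/implyP := prop u; apply; apply/orP; left.
    apply/forallP => i; apply/and3P; split.
    - have := adjneq (X_hub k) (X_m i); rewrite !ffunE /= inordK // eq_sym; apply.
      by apply/or3P/Or32/existsP; exists i; rewrite !eqxx.
    - apply/forallP => t.
      have K s : paint h g (Some (i, inl s)) != paint h g (Some (i, inr t)).
        apply: adjneq; apply/or3P/Or31/existsP; exists i.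
        by apply/existsP; exists s; apply/existsP; exists t; rewrite !eqxx.
      have := K (inord 0); have := K (inord 1); have := K (inord 2).
      rewrite !ffunE /= !inordK //= !inE !(eq_sym (colour_abc _ _)).
      by move=> /negPf-> /negPf-> /negPf->.
    - have := adjneq (X_r i) (X_l (ordS i)); rewrite !ffunE /= !inordK //; apply.
      by apply/or3P/Or33/existsP; exists i; rewrite !eqxx.
  have adjneq u v : X_arc u v -> paint h g u != paint h g v.
    case/or3P.
    - case/existsP=> i /existsP[s] /existsP[t] /andP[/eqP-> /eqP->]; rewrite !ffunE.
      have /and3P[_ /forallP/(_ t) abc _] := PP i; apply: contraNneq abc => <-.
      by rewrite mem_nth.
    - case/existsP=> i /andP[/eqP-> /eqP->]; rewrite !ffunE /= inordK // eq_sym.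
      by have /and3P[] := PP i.
    - case/existsP=> i /andP[/eqP-> /eqP->]; rewrite !ffunE /= !inordK //.
      by have /and3P[] := PP i.
  apply/forallP => u; apply/forallP => v; apply/implyP => /orP[/adjneq //|].
  by rewrite eq_sym; apply: adjneq.
rewrite -prod_natb; apply: eq_bigr => i _.
by rewrite /P /block_weight mxE prod_natb -!natrM !mulnb andbA.
Qed.

Lemma sum_block_weight h :
  \matrix_(x, y) (\sum_(c | (colour_l c == x) && (colour_r c == y)) block_weight h c) = blockmx h.
Proof.
apply/matrixP => x y; rewrite !mxE.
transitivity (\sum_(z | z != h) \sum_(a : {ffun 'I_3 -> 'I_q})
    \prod_t ((a t \notin [:: x; z; y])%:R : int)).
  rewrite (reindex_onto (fun p : 'I_q * {ffun 'I_3 -> 'I_q} => (x, p.1, y, p.2))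
                        (fun c => (colour_m c, colour_abc c))) => [|[[[l m] r] a]]; last first.
    by case/andP => /= /eqP<- /eqP<-.
  rewrite (eq_bigl predT) => [|[z a]]; last by rewrite /= !eqxx.
  rewrite pair_big_dep [RHS]big_mkcond /=; apply: eq_bigr => -[z a] _.
  by rewrite /block_weight andbT /=; case: ifP; rewrite ?mul1r ?mul0r.
apply: eq_bigr => z _.
rewrite -(bigA_distr_bigA (fun (_ : 'I_3) w => (w \notin [:: x; z; y])%:R : int)) /=.
by rewrite prodr_const card_ord.
Qed.
End Colourings.

Lemma count_colourings k q :
  ((num_proper_colourings (X k.+1) q)%:R : int) =
  \sum_(h : 'I_q) \tr ((blockmx h *m neqmx q) ^+ k.+1).
Proof.
rewrite /num_proper_colourings -sum1_card natr_sum big_mkcond /=.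
rewrite (eq_bigr (fun f => (@proper_colouring (X k.+1) q f)%:R)); last first.
  by move=> f _; rewrite inE; case: proper_colouring.
rewrite (@big_paint _ _ (fun f => (proper_colouring f)%:R)); apply: eq_bigr => h _.
under eq_bigr => g _ do rewrite proper_paint.
by rewrite transfer_trace sum_block_weight.
Qed.

Lemma chromatic_poly_X_factor k : (0 < k)%N ->
  exists Q : {poly int}, chromatic_poly (X k) = ('X - 2%:P) ^+ k * Q.
Proof.
case: k => // k _.
have [a [b [c [d [e AE]]]]] := transfermx_graded.
have [a' [b' [c' [d' [e' AkE]]]]] := graded_hubmx_exp k AE.
exists ('X * (a' + ('X - 1%:P) * (d' + e'))).
apply: is_chromatic_poly_unique (chromatic_polyP _) _ => q.
rewrite count_colourings.
transitivity (\sum_(h : 'I_q) ((q%:R - 2) ^+ k.+1 *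
    (a'.[q%:R] + (q%:R - 1) * (d'.[q%:R] + e'.[q%:R])) : int)).
  rewrite sumr_const card_ord -[RHS]mulr_natl.
  rewrite !(hornerXsubC, hornerM, horner_exp, hornerD, hornerX); ring.
by apply: eq_bigr => h _; rewrite AkE mxtrace_hubmx; ring.
Qed.

(** * Connectivity of X(k) *)

Section Rim.
Local Open Scope nat_scope.
Variable k : nat.
Hypothesis k_ge3 : (2 < k)%N.

Lemma ordS_neq (i : 'I_k) : ordS i != i.
Proof.
rewrite -val_eqE /=; have := ltn_ord i => ik.
have [E|?] := eqVneq i.+1 k; first by rewrite E modnn; lia.
by rewrite modn_small; lia.
Qed.

Lemma ordSS_neq (i : 'I_k) : ordS (ordS i) != i.
Proof.
rewrite -val_eqE /= -addn1 modnDml addn1; have := ltn_ord i => ik.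
have [E|?] := eqVneq i.+1 k; first by rewrite -addn1 E modnDl modn_small; lia.
have [E|?] := eqVneq i.+2 k; first by rewrite E modnn; lia.
by rewrite modn_small; lia.
Qed.

(** A table by coordinates, so that case analysis on vertices computes. *)
Definition X_adj_table (u v : X_vertex k) : bool :=
  match u, v with
  | None, None => false
  | None, Some (_, inl s) | Some (_, inl s), None => s == 1%N :> nat
  | None, Some (_, inr _) | Some (_, inr _), None => false
  | Some (i, inl _), Some (j, inr _) | Some (i, inr _), Some (j, inl _) => i == j
  | Some (i, inl s), Some (j, inl t) =>
      [&& s == 2%N :> nat, t == 0%N :> nat & j == ordS i]
      || [&& t == 2%N :> nat, s == 0%N :> nat & i == ordS j]
  | Some (i, inr _), Some (j, inr _) => false
  end.

Lemma X_arc_table u v : X_arc u v -> X_adj_table u v.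
Proof.
case/or3P.
- by case/existsP=> i /existsP[s] /existsP[t] /andP[/eqP-> /eqP->] /=.
- by case/existsP=> i /andP[/eqP-> /eqP->] /=; rewrite inordK.
- by case/existsP=> i /andP[/eqP-> /eqP->] /=; rewrite !inordK //= eqxx.
Qed.

Lemma X_adj_table_sym : symmetric X_adj_table.
Proof.
by move=> [[i [s|t]]|] [[j [s'|t']]|] //=; by [exact: orbC | exact: eq_sym].
Qed.

Lemma X_adj_tableP u v : X_adj u v -> X_adj_table u v.
Proof. by case/orP=> /X_arc_table //; rewrite X_adj_table_sym. Qed.

(** A triangle cannot contain the hub, whose neighbours m_i are not adjacent,
    and not all its edges are in one K_{3,3}; so it has an edge r_i l_(i+1),
    whose ends have a common neighbour only if i = i + 1. *)
Lemma X_triangle_free (u v w : X k) : sadj u v -> sadj v w -> sadj u w -> False.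
Proof.
move=> /X_adj_tableP + /X_adj_tableP + /X_adj_tableP.
case: u v w => [[i [s|t]]|] [[j [s'|t']]|] [[l [s''|t'']]|] //=.
- by move=> *; lia.
- move=> + /eqP<- => H ij; move: H.
  by rewrite (eqP ij) (eq_sym _ (ordS _)) (negPf (ordS_neq _)) !andbF.
- by move=> *; lia.
- by move=> /eqP-> /eqP->; rewrite (eq_sym _ (ordS _)) (negPf (ordS_neq _)) !andbF.
- by move=> *; lia.
- by move=> /eqP-> H /eqP jl; move: H; rewrite jl (eq_sym _ (ordS _)) (negPf (ordS_neq _)) !andbF.
- by move=> *; lia.
Qed.

Lemma clique_card (S : {set X k}) :
  (forall x y, x \in S -> y \in S -> x != y -> sadj x y) -> (#|S| < 3)%N.
Proof.
move=> clique; rewrite ltnNge; apply/negP => /card_gt2P[u [v [w [[uS vS wS] [uv vw wu]]]]].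
by apply: (@X_triangle_free u v w); apply: clique => //; rewrite eq_sym.
Qed.

Lemma val_iter_ordS n (i : 'I_k) : iter n (@ordS k) i = (i + n) %% k :> nat.
Proof.
elim: n => [|n IHn] /=; first by rewrite addn0 modn_small.
by rewrite IHn -addn1 modnDml addn1 addnS.
Qed.

Section Deletion.
Variable S : {set X k}.
Hypothesis S_lt3 : (#|S| < 3)%N.

Local Notation vtx := (X_vertex k).

Definition linked : rel (X k) :=
  connect [rel u v : X k | [&& u \in ~: S, v \in ~: S & sadj u v]].

Lemma linked_sym : symmetric linked.
Proof.
apply: sym_connect_sym => u v /=; rewrite andbCA; congr [&& _, _ & _].
exact: X_adj_sym.
Qed.

Lemma linked_adj (u v : X k) : u \notin S -> v \notin S -> sadj u v -> linked u v.
Proof. by move=> uS vS uv; apply: connect1; rewrite /= !inE uS vS. Qed.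

Lemma linked_trans (v u w : X k) : linked u v -> linked v w -> linked u w.
Proof. exact: connect_trans. Qed.

Lemma no_three_deleted (u v w : X k) :
  u \in S -> v \in S -> w \in S -> u != v -> v != w -> w != u -> False.
Proof.
move=> uS vS wS uv vw wu; have /card_gt2P : exists x y z, [/\ x \in S, y \in S & z \in S]
  /\ [/\ x != y, y != z & z != x] by exists u, v, w.
by rewrite ltnNge -ltnS S_lt3.
Qed.

(** Used for either side of a copy of K_{3,3}: one of its three vertices is left. *)
Lemma survivor (f : 'I_3 -> X k) : injective f -> exists s, f s \notin S.
Proof.
move=> f_inj; apply/existsP; apply: contraT => /existsPn fS; exfalso.
have {}fS s : f s \in S by have := fS s; rewrite negbK.
by apply: (no_three_deleted (fS (inord 0)) (fS (inord 1)) (fS (inord 2)));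
  rewrite (inj_eq f_inj) -val_eqE /= !inordK.
Qed.

Lemma adj_block i s t : sadj (Some (i, inl s) : X k) (Some (i, inr t)).
Proof.
apply/orP; left; apply/or3P/Or31/existsP; exists i.
by apply/existsP; exists s; apply/existsP; exists t; rewrite !eqxx.
Qed.

Lemma adj_spoke i : sadj (X_hub k : X k) (X_m i).
Proof. by apply/orP; left; apply/or3P/Or32/existsP; exists i; rewrite !eqxx. Qed.

Lemma adj_rim i : sadj (X_r i : X k) (X_l (ordS i)).
Proof. by apply/orP; left; apply/or3P/Or33/existsP; exists i; rewrite !eqxx. Qed.

(** Two vertices on the same side are joined through a surviving vertex of the
    other side. *)
Lemma linked_block (i : 'I_k) a b : (Some (i, a) : X k) \notin S ->
  (Some (i, b) : X k) \notin S -> linked (Some (i, a)) (Some (i, b)).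
Proof.
have cross s t : (Some (i, inl s) : X k) \notin S -> (Some (i, inr t) : X k) \notin S ->
    linked (Some (i, inl s)) (Some (i, inr t)).
  by move=> sS tS; apply: linked_adj => //; exact: adj_block.
have [s0 s0S] : exists s, (Some (i, inl s) : X k) \notin S.
  by apply: (@survivor (fun s => Some (i, inl s))) => s s' [].
have [t0 t0S] : exists t, (Some (i, inr t) : X k) \notin S.
  by apply: (@survivor (fun s => Some (i, inr s))) => s s' [].
case: a b => [s|t] [s'|t'] aS bS.
- by apply: (linked_trans (cross _ _ aS t0S)); rewrite linked_sym cross.
- exact: cross.
- by rewrite linked_sym cross.
- by apply: (@linked_trans (Some (i, inl s0))); [rewrite linked_sym|]; exact: cross.
Qed.

Lemma rim_eq (i j : 'I_k) a b : (a < 3)%N -> (b < 3)%N ->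
  ((Some (i, inl (inord a)) : vtx) == Some (j, inl (inord b))) = (i == j) && (a == b).
Proof.
move=> a3 b3; apply/eqP/andP => [[-> /(congr1 val)] | [/eqP-> /eqP->] //].
by rewrite /= !inordK // => ->.
Qed.

(** Where m_i is deleted, a route to the hub leads through r_i, l_(i+1), m_(i+1)
    or through l_i, r_(i-1), m_(i-1). *)
Lemma linked_hub (u : X k) : (X_hub k : X k) \notin S -> u \notin S -> linked u (X_hub k).
Proof.
move=> hS; have spoke i a : (X_m i : X k) \notin S -> (Some (i, a) : X k) \notin S ->
    linked (Some (i, a)) (X_hub k).
  move=> mS aS; apply: (@linked_trans (X_m i)); first exact: linked_block.
  by rewrite linked_sym; apply: linked_adj => //; exact: adj_spoke.
case: u => [[i a]|] aS; last exact: connect0.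
have [mS|] := boolP ((X_m i : X k) \in S); last by move/spoke; apply.
pose p := ord_pred i; have pE : i = ordS p by rewrite ord_predK.
have := ordS_neq i; have := ordS_neq p; have := ordSS_neq p; rewrite -pE => ipp ip ii.
have [fwd|] := boolP [&& (X_r i : X k) \notin S, (X_l (ordS i) : X k) \notin S
                       & (X_m (ordS i) : X k) \notin S].
  case/and3P: fwd => rS lS mS'; apply: (@linked_trans (X_r i)); first exact: linked_block.
  apply: (@linked_trans (X_l (ordS i))); last exact: spoke.
  by apply: linked_adj => //; exact: adj_rim.
have [bwd _|] := boolP [&& (X_l i : X k) \notin S, (X_r p : X k) \notin S
                       & (X_m p : X k) \notin S].
  case/and3P: bwd => lS rS mS'; apply: (@linked_trans (X_l i)); first exact: linked_block.
  apply: (@linked_trans (X_r p)); last exact: spoke.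
  by rewrite linked_sym; apply: linked_adj => //; rewrite pE; exact: adj_rim.
(* Otherwise m_i, a vertex of the passage forwards and one of the passage
   backwards are three deleted vertices. *)
by rewrite !negb_and !negbK => /or3P[] bS /or3P[] fS; exfalso;
  apply: (no_three_deleted mS bS fS);
  rewrite rim_eq //= ?andbT ?andbF // 1?eq_sym // 1?eq_sym.
Qed.

(** With the hub deleted only one other vertex is missing, so only one link
    r_i l_(i+1) can be broken; starting just after it, the copies can be walked
    through one by one without crossing it. *)
Lemma linked_rim (u v : X k) : (X_hub k : X k) \in S ->
  u \notin S -> v \notin S -> linked u v.
Proof.
move=> hS.
pose cut (i : 'I_k) := ((X_r i : X k) \in S) || ((X_l (ordS i) : X k) \in S).
have [i0 cutP] : exists i0, forall i, i != i0 -> ~~ cut i.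
  have [/existsP[i0 ci0]|/existsPn nc] := boolP [exists i, cut i]; last first.
    by exists (Ordinal (ltn_trans (isT : 0 < 2)%N k_ge3)).
  exists i0 => i ii0; apply/negP => ci.
  by case/orP: ci0 => i0S; case/orP: ci => iS; apply: (no_three_deleted hS i0S iS) => //;
    rewrite rim_eq //= ?andbF // andbT ?(inj_eq (@ordS_inj k)) eq_sym.
pose j := ordS i0.
have chain n a b : (n < k)%N -> (Some (j, a) : X k) \notin S ->
    (Some (iter n (@ordS k) j, b) : X k) \notin S ->
    linked (Some (j, a)) (Some (iter n (@ordS k) j, b)).
  elim: n b => [|n IHn] b nk aS bS; first exact: linked_block.
  have : ~~ cut (iter n (@ordS k) j).
    apply: cutP; rewrite -val_eqE /= /j -iterSr val_iter_ordS.
    have ik := ltn_ord i0.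
    have [lt|ge] := ltnP (i0 + n.+1) k; first by rewrite modn_small //; lia.
    by rewrite -(subnK ge) modnDr modn_small; lia.
  rewrite negb_or => /andP[rS lS].
  apply: (linked_trans (IHn _ (ltnW nk) aS rS)).
  apply: (@linked_trans (X_l (iter n.+1 (@ordS k) j))); last exact: linked_block.
  by apply: linked_adj => //; exact: adj_rim.
have [s sS] : exists s, (Some (j, inl s) : X k) \notin S.
  by apply: (@survivor (fun s => Some (j, inl s))) => s s' [].
have reach (w : X k) : w \notin S -> linked (Some (j, inl s)) w.
  case: w => [[i a]|]; last by rewrite hS.
  have -> : i = iter ((i + (k - j)) %% k) (@ordS k) j.
    apply: val_inj; rewrite /= val_iter_ordS modnDmr.
    by rewrite addnCA subnKC ?modnDr ?modn_small // ltnW.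
  by move=> aS; apply: chain => //; rewrite ltn_mod; lia.
by move=> uS vS; apply: (@linked_trans (Some (j, inl s))); rewrite ?(linked_sym u) reach.
Qed.

Lemma X_deletion_connected : connected_on (~: S).
Proof.
apply/forall_inP => u; rewrite inE => uS; apply/forall_inP => v; rewrite inE => vS.
have [hS|hS] := boolP ((X_hub k : X k) \in S); first exact: linked_rim.
by apply: (linked_trans (linked_hub hS uS)); rewrite linked_sym linked_hub.
Qed.

End Deletion.

Lemma X_three_connected : three_connected (X k).
Proof.
split; last exact: X_deletion_connected.
by rewrite card_option card_prod card_sum !card_ord; lia.
Qed.

Lemma X_no_complete_cutset : ~ exists S : {set X k}, complete_cutset S.
Proof. by case=> S [/clique_card S_lt3]; rewrite X_deletion_connected. Qed.

End Rim.

Theorem corollary3p1 :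
  (forall k : nat, (1 <= k)%N ->
     exists Q : {poly int}, chromatic_poly (X k) = ('X - 2%:P) ^+ k * Q) /\
  (forall k : nat, (3 <= k)%N ->
     three_connected (X k) /\
     ~ (exists S : {set X k}, complete_cutset S)).
Proof.
split=> k k_gt; first exact: chromatic_poly_X_factor.
by split; [exact: X_three_connected | exact: X_no_complete_cutset].
Qed.
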